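(* Let $(\mathbb{N}_0,+,0)$ be the monoidal category whose underlying category is the poset $(\mathbb{N}_0,\leq)$, with tensor product given by addition and unit $0$. Hopf monads on $(\mathbb{N}_0,+,0)$ are in bijection with the submonoids $\langle n\rangle=\{0,n,2n,\dots\}$ of $(\mathbb{N}_0,+)$ generated by a single non-zero element $n\in\mathbb{N}_0$; the bijection sends a Hopf monad $T$ to the image $S_T=\{T(m)\mid m\in\mathbb{N}_0\}$.
   Context: $\mathbb{N}_0=\{0,1,2,\dots\}$; the poset $(\mathbb{N}_0,\le)$ is viewed as a category with a unique arrow $m\to n$ exactly when $m\le n$. A bimonad on a monoidal category $(\mathcal{C},\otimes,1)$ is a monad $(T,\mu,\eta)$ together with a natural transformation $T_2(X,Y):T(X\otimes Y)\to T(X)\otimes T(Y)$ and a morphism $T_0:T(1)\to 1$ that are coassociative and counital (i.e. $T$ is a comonoidal functor) and such that $\mu,\eta$ are comonoidal: $T_2(X,Y)\mu_{X\otimes Y}=(\mu_X\otimes\mu_Y)T_2(T(X),T(Y))T(T_2(X,Y))$, $T_2(X,Y)\eta_{X\otimes Y}=\eta_X\otimes\eta_Y$, $T_0\mu_1=T_0T(T_0)$, $T_0\eta_1=\mathrm{id}_1$. Its fusion operators are $H^l_{X,Y}=(\mathrm{id}_{T(X)}\otimes\mu_Y)T_2(X,T(Y)):T(X\otimes T(Y))\to T(X)\otimes T(Y)$ and $H^r_{X,Y}=(\mu_X\otimes\mathrm{id}_{T(Y)})T_2(T(X),Y):T(T(X)\otimes Y)\to T(X)\otimes T(Y)$. The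 bimonad is a Hopf monad if $H^l$ and $H^r$ are both invertible. *)

(* Defs.v *)
From mathcomp Require Import all_boot all_classical.

Set Implicit Arguments.
Unset Strict Implicit.
Unset Printing Implicit Defensive.

Local Open Scope classical_set_scope.

Declare Scope cat_scope.
Delimit Scope cat_scope with cat.
Local Open Scope cat_scope.

Reserved Notation "g ∘ f" (at level 40, left associativity).
Reserved Notation "X ⊗ Y" (at level 39, left associativity).
Reserved Notation "f ⊠ g" (at level 39, left associativity).

(** [g ∘ f] is [g] after [f]. *)

Record category := Category {
  obj :> Type;
  hom : obj -> obj -> Type;
  idm : forall X, hom X X;
  compose : forall X Y Z, hom Y Z -> hom X Y -> hom X Z;
  compose_idl : forall X Y (f : hom X Y), compose (idm Y) f = f;
  compose_idr : forall X Y (f : hom X Y), compose f (idm X) = f;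
  composeA : forall X Y Z W (h : hom Z W) (g : hom Y Z) (f : hom X Y),
    compose h (compose g f) = compose (compose h g) f }.

Arguments hom {c} X Y.
Arguments idm {c} X.
Arguments compose {c X Y Z} g f.
Notation "g ∘ f" := (compose g f) : cat_scope.

Definition is_iso (C : category) (X Y : C) (f : hom X Y) : Prop :=
  exists g : hom Y X, g ∘ f = idm X /\ f ∘ g = idm Y.

(** Not assumed strict; [X ⊗ Y] is the tensor product of objects and [f ⊠ g]
    that of morphisms. *)

Record monoidal_category := MonoidalCategory {
  mcat :> category;
  tens : mcat -> mcat -> mcat;
  tensm : forall X X' Y Y' : mcat,
    hom X X' -> hom Y Y' -> hom (tens X Y) (tens X' Y');
  unit_obj : mcat;
  assoc : forall X Y Z, hom (tens (tens X Y) Z) (tens X (tens Y Z));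
  lunit : forall X, hom (tens unit_obj X) X;
  runit : forall X, hom (tens X unit_obj) X;
  tensm_id : forall X Y, tensm (idm X) (idm Y) = idm (tens X Y);
  tensm_comp : forall X X' X'' Y Y' Y'' (f' : hom X' X'') (f : hom X X')
      (g' : hom Y' Y'') (g : hom Y Y'),
    tensm (f' ∘ f) (g' ∘ g) = tensm f' g' ∘ tensm f g;
  assoc_nat : forall X X' Y Y' Z Z'
      (f : hom X X') (g : hom Y Y') (h : hom Z Z'),
    assoc X' Y' Z' ∘ tensm (tensm f g) h = tensm f (tensm g h) ∘ assoc X Y Z;
  lunit_nat : forall X X' (f : hom X X'),
    lunit X' ∘ tensm (idm unit_obj) f = f ∘ lunit X;
  runit_nat : forall X X' (f : hom X X'),
    runit X' ∘ tensm f (idm unit_obj) = f ∘ runit X;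
  assoc_iso : forall X Y Z, is_iso (assoc X Y Z);
  lunit_iso : forall X, is_iso (lunit X);
  runit_iso : forall X, is_iso (runit X);
  pentagon : forall X Y Z W,
    assoc X Y (tens Z W) ∘ assoc (tens X Y) Z W =
    tensm (idm X) (assoc Y Z W) ∘ assoc X (tens Y Z) W
      ∘ tensm (assoc X Y Z) (idm W);
  triangle : forall X Y,
    tensm (idm X) (lunit Y) ∘ assoc X unit_obj Y = tensm (runit X) (idm Y) }.

Arguments tens {m} X Y.
Arguments tensm {m X X' Y Y'} f g.
Arguments unit_obj {m}.
Arguments assoc {m} X Y Z.
Arguments lunit {m} X.
Arguments runit {m} X.
Notation "X ⊗ Y" := (tens X Y) : cat_scope.
Notation "f ⊠ g" := (tensm f g) : cat_scope.

Record endofunctor (C : category) := Endofunctor {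
  fobj :> C -> C;
  fmor : forall X Y : C, hom X Y -> hom (fobj X) (fobj Y);
  fmor_id : forall X, fmor (idm X) = idm (fobj X);
  fmor_comp : forall X Y Z (g : hom Y Z) (f : hom X Y),
    fmor (g ∘ f) = fmor g ∘ fmor f }.

Arguments fmor {C} e {X Y} f.

Record monad (C : category) := Monad {
  mfun :> endofunctor C;
  mu : forall X, hom (mfun (mfun X)) (mfun X);
  eta : forall X, hom X (mfun X);
  mu_nat : forall X Y (f : hom X Y),
    mu Y ∘ fmor mfun (fmor mfun f) = fmor mfun f ∘ mu X;
  eta_nat : forall X Y (f : hom X Y), eta Y ∘ f = fmor mfun f ∘ eta X;
  mu_assoc : forall X, mu X ∘ fmor mfun (mu X) = mu X ∘ mu (mfun X);
  mu_etal : forall X, mu X ∘ eta (mfun X) = idm (mfun X);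
  mu_etar : forall X, mu X ∘ fmor mfun (eta X) = idm (mfun X) }.

Arguments mu {C} m X.
Arguments eta {C} m X.

Record bimonad (C : monoidal_category) := Bimonad {
  bmonad :> monad C;
  T2 : forall X Y : C, hom (bmonad (X ⊗ Y)) (bmonad X ⊗ bmonad Y);
  T0 : hom (bmonad unit_obj) (unit_obj : C);
  T2_nat : forall (X X' Y Y' : C) (f : hom X X') (g : hom Y Y'),
    T2 X' Y' ∘ fmor bmonad (f ⊠ g) = (fmor bmonad f ⊠ fmor bmonad g) ∘ T2 X Y;
  T2_coassoc : forall X Y Z,
    assoc (bmonad X) (bmonad Y) (bmonad Z)
      ∘ (T2 X Y ⊠ idm (bmonad Z)) ∘ T2 (X ⊗ Y) Z =
    (idm (bmonad X) ⊠ T2 Y Z) ∘ T2 X (Y ⊗ Z) ∘ fmor bmonad (assoc X Y Z);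
  T2_counitl : forall X,
    lunit (bmonad X) ∘ (T0 ⊠ idm (bmonad X)) ∘ T2 unit_obj X =
    fmor bmonad (lunit X);
  T2_counitr : forall X,
    runit (bmonad X) ∘ (idm (bmonad X) ⊠ T0) ∘ T2 X unit_obj =
    fmor bmonad (runit X);
  T2_mu : forall X Y,
    T2 X Y ∘ mu bmonad (X ⊗ Y) =
    (mu bmonad X ⊠ mu bmonad Y) ∘ T2 (bmonad X) (bmonad Y)
      ∘ fmor bmonad (T2 X Y);
  T2_eta : forall X Y, T2 X Y ∘ eta bmonad (X ⊗ Y) = eta bmonad X ⊠ eta bmonad Y;
  T0_mu : T0 ∘ mu bmonad unit_obj = T0 ∘ fmor bmonad T0;
  T0_eta : T0 ∘ eta bmonad unit_obj = idm unit_obj }.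

Arguments T2 {C} b X Y.
Arguments T0 {C} b.

Section Fusion.
Variables (C : monoidal_category) (T : bimonad C).

Definition fusion_l (X Y : C) : hom (T (X ⊗ T Y)) (T X ⊗ T Y) :=
  (idm (T X) ⊠ mu T Y) ∘ T2 T X (T Y).

Definition fusion_r (X Y : C) : hom (T (T X ⊗ Y)) (T X ⊗ T Y) :=
  (mu T X ⊠ idm (T Y)) ∘ T2 T (T X) Y.

End Fusion.

Record hopf_monad (C : monoidal_category) := HopfMonad {
  hbimonad :> bimonad C;
  fusion_l_iso : forall X Y, is_iso (fusion_l hbimonad X Y);
  fusion_r_iso : forall X Y, is_iso (fusion_r hbimonad X Y) }.

(** The poset of natural numbers: the hom-type from [m] to [n] is the
    proposition [m <= n], which has at most one proof, so every diagram
    commutes. *)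

Definition nat_category : category.
Proof.
refine {|
  obj := nat;
  hom := fun m n => is_true (m <= n);
  idm := leqnn;
  compose := fun m n p (g : n <= p) (f : m <= n) => leq_trans f g |};
  move=> *; exact: bool_irrelevance.
Defined.

Lemma nat_is_iso (m n : nat_category) (f : hom m n) : n <= m -> is_iso f.
Proof. by move=> le_nm; exists le_nm; split; exact: bool_irrelevance. Qed.

Definition nat_monoidal : monoidal_category.
Proof.
unshelve refine {|
  mcat := nat_category;
  tens := addn;
  tensm := fun m m' n n' (f : m <= m') (g : n <= n') => leq_add f g;
  unit_obj := 0 |}.
- by move=> m n p /=; rewrite addnA.
- by move=> n /=.
- by move=> n /=; rewrite addn0.
all: move=> *; try exact: bool_irrelevance.
- by apply: nat_is_iso; rewrite addnA.
- exact: nat_is_iso.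
- by apply: nat_is_iso; rewrite addn0.
Defined.

Definition submonoid (S : set nat) : Prop :=
  S 0 /\ (forall a b, S a -> S b -> S (a + b)).

Definition submonoid_gen (n : nat) : set nat := smallest submonoid [set n].

Lemma submonoid_genE (n : nat) : submonoid_gen n = range (fun k => k * n).
Proof.
apply/seteqP; split=> [|_ [k _ <-]].
- apply: smallest_sub; last by move=> _ ->; exists 1 => //; rewrite mul1n.
  split=> [|_ _ [k _ <-] [l _ <-]]; first by exists 0.
  by exists (k + l) => //; rewrite mulnDl.
- move=> S [[S0 SD] Sn]; elim: k => [|k IHk] //.
  by rewrite mulSn; apply: SD => //; apply: Sn.
Qed.

Definition hopf_image (T : hopf_monad nat_monoidal) : set nat :=
  range (T : nat -> nat).

(* Main.v *)
Require Import Defs.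
From mathcomp Require Import all_boot all_classical.

(** In a poset every diagram commutes, so a Hopf monad on [nat_monoidal] is
    just a function [T] on the natural numbers satisfying inequalities: it is
    monotone, inflationary and idempotent (a closure operator, [closureP]), it
    fixes [0] because of the counit, and, since one fusion operator and its
    inverse give inequalities in both directions, [T (m + T p) = T m + T p]
    ([fusion_addE]).

    A closure operator is determined by its image, which is its set of fixed
    points: [T m] is the least of them above [m].  This gives injectivity.  The
    fusion equation makes the set of fixed points closed under addition and,
    by cancelling, under subtraction.  Such a set contains the remainders of
    its elements modulo its least positive element [T 1], so these vanish and
    the set consists of the multiples of [T 1] ([hopf_imageE]).

    Conversely, for positive [n], rounding up to a multiple of [n] is left
    adjoint to the inclusion of the multiples of [n] ([roundup_leq]); since the
    multiples form a submonoid and translation by a multiple commutes with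
    rounding, all the required inequalities follow. *)

Set Implicit Arguments.
Unset Strict Implicit.
Unset Printing Implicit Defensive.

Local Open Scope classical_set_scope.

(** * Structures on thin categories *)

Definition thin (C : category) := forall (X Y : C) (f g : hom X Y), f = g.

Lemma thin_endofunctor_eq (C : category) (F G : endofunctor C) :
  thin C -> (F : C -> C) = G -> F = G.
Proof.
move=> thinC; case: F G => [F Fm Fi Fc] [G Gm Gi Gc] /= eqFG; subst G.
have eqm : Fm = Gm by do 3![apply: functional_extensionality_dep => ?]; exact: thinC.
by subst Gm; congr Endofunctor; exact: Prop_irrelevance.
Qed.

Lemma thin_monad_eq (C : category) (S T : monad C) :
  thin C -> (S : C -> C) = T -> S = T.
Proof.
move=> thinC /(thin_endofunctor_eq thinC).
case: S T => [F m e ? ? ? ? ?] [G m' e' ? ? ? ? ?] /= eqFG; subst G.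
have eqm : m = m' by apply: functional_extensionality_dep => ?; exact: thinC.
have eqe : e = e' by apply: functional_extensionality_dep => ?; exact: thinC.
by subst m' e'; congr Monad; exact: Prop_irrelevance.
Qed.

Lemma thin_bimonad_eq (C : monoidal_category) (S T : bimonad C) :
  thin C -> (S : C -> C) = T -> S = T.
Proof.
move=> thinC /(thin_monad_eq thinC).
case: S T => [F t2 t0 ? ? ? ? ? ? ? ?] [G t2' t0' ? ? ? ? ? ? ? ?] /= eqFG.
subst G.
have eq2 : t2 = t2'.
  by do 2![apply: functional_extensionality_dep => ?]; exact: thinC.
have eq0 : t0 = t0' by exact: thinC.
by subst t2' t0'; congr Bimonad; exact: Prop_irrelevance.
Qed.

(** The data of a Hopf monad other than its action on objects are families of
    morphisms, which a thin category determines by their sources and targets. *)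
Lemma thin_hopf_monad_eq (C : monoidal_category) (S T : hopf_monad C) :
  thin C -> (S : C -> C) = T -> S = T.
Proof.
move=> thinC /(thin_bimonad_eq thinC).
case: S T => [F ? ?] [G ? ?] /= eqFG; subst G.
by congr HopfMonad; exact: Prop_irrelevance.
Qed.

Lemma nat_thin : thin nat_category.
Proof. by move=> m n f g; exact: bool_irrelevance. Qed.

(** * Hopf monads on the natural numbers as closure operators *)

Section HopfMonadOnNat.
Variable T : hopf_monad nat_monoidal.

Let t : nat -> nat := T.

Lemma hopf_mono (m p : nat) : m <= p -> t m <= t p.
Proof. exact: (@fmor nat_category T m p). Qed.

Lemma hopf_le (m : nat) : m <= t m.
Proof. exact: (eta T m). Qed.

Lemma hopf_idem (m : nat) : t (t m) = t m.
Proof. by apply/eqP; rewrite eqn_leq hopf_le andbT; exact: (mu T m). Qed.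

Lemma hopf0 : t 0 = 0.
Proof. by apply/eqP; rewrite -leqn0; exact: (T0 T). Qed.

Lemma fusion_addE (m p : nat) : t (m + t p) = t m + t p.
Proof.
apply/eqP; rewrite eqn_leq; apply/andP; split.
  exact: (fusion_l T m p).
by have [g _] := @fusion_l_iso _ T m p; exact: g.
Qed.

Lemma hopf_imageP (s : nat) : hopf_image T s <-> t s = s.
Proof. by split=> [[m _ <-]|ts]; [exact: hopf_idem | exists s]. Qed.

Lemma closureP (m s : nat) : hopf_image T s -> (t m <= s) = (m <= s).
Proof.
move=> /hopf_imageP ts; apply/idP/idP; first exact: leq_trans (hopf_le m).
by move=> /hopf_mono; rewrite ts.
Qed.

(** If [s] and [u] are fixed with [u <= s], then
    [t (s - u) + u = t (s - u + u) = s], and [u] cancels. *)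
Lemma hopf_image_sub (s u : nat) :
  u <= s -> hopf_image T s -> hopf_image T u -> hopf_image T (s - u).
Proof.
move=> le_us /hopf_imageP ts /hopf_imageP tu; apply/hopf_imageP.
by apply: (@addIn u); rewrite subnK // -[in LHS]tu -fusion_addE tu subnK.
Qed.

Lemma hopf_image_muln (k : nat) : hopf_image T (k * t 1).
Proof.
apply/hopf_imageP; elim: k => [|k IHk]; first exact: hopf0.
by rewrite mulSn addnC fusion_addE IHk.
Qed.

(** The remainder of a fixed point modulo [t 1] is again fixed, and it is
    smaller than [t 1], the least positive fixed point; so it vanishes. *)
Lemma hopf_imageE : hopf_image T = submonoid_gen (t 1).
Proof.
rewrite submonoid_genE; apply/seteqP; split=> [s Ss|_ [k _ <-]]; last first.
  exact: hopf_image_muln.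
exists (s %/ t 1) => //.
have Sr : hopf_image T (s %% t 1).
  have -> : s %% t 1 = s - s %/ t 1 * t 1 by rewrite {2}(divn_eq s (t 1)) addKn.
  by apply: hopf_image_sub (hopf_image_muln _); first exact: leq_divM.
have : ~~ (0 < s %% t 1) by rewrite -(closureP 1 Sr) -ltnNge ltn_pmod ?hopf_le.
by rewrite -eqn0Ngt => /eqP r0; rewrite {2}(divn_eq s (t 1)) r0 addn0.
Qed.

End HopfMonadOnNat.

(** Each of [S m] and [T m] is the least element above [m] of the common
    image. *)
Lemma hopf_image_inj : injective hopf_image.
Proof.
move=> S T eqST; apply: thin_hopf_monad_eq; first exact: nat_thin.
apply: functional_extensionality_dep => m; apply/eqP; rewrite eqn_leq.
apply/andP; split.
  by rewrite closureP; [exact: hopf_le | rewrite eqST; exists m].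
by rewrite closureP; [exact: hopf_le | rewrite -eqST; exists m].
Qed.

(** * Rounding up to a multiple *)

Section Roundup.
Variable n : nat.
Hypothesis n_gt0 : 0 < n.

Definition roundup (m : nat) : nat := (m + n.-1) %/ n * n.

Lemma roundup_leq (m k : nat) : (roundup m <= k * n) = (m <= k * n).
Proof.
rewrite /roundup leq_pmul2r // -ltnS ltn_divLR //.
by rewrite mulSn -[X in _ < X + _](prednK n_gt0) addSn ltnS addnC leq_add2l.
Qed.

Lemma roundup_ge (m : nat) : m <= roundup m.
Proof. by rewrite -roundup_leq. Qed.

Lemma roundup_mono (m p : nat) : m <= p -> roundup m <= roundup p.
Proof. by move=> le_mp; rewrite roundup_leq (leq_trans le_mp) ?roundup_ge. Qed.

Lemma roundup_idem (m : nat) : roundup (roundup m) <= roundup m.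
Proof. by rewrite roundup_leq. Qed.

Lemma roundup_muln (k : nat) : roundup (k * n) = k * n.
Proof. by apply/eqP; rewrite eqn_leq roundup_ge roundup_leq leqnn. Qed.

Lemma roundup_add (m p : nat) : roundup (m + p) <= roundup m + roundup p.
Proof. by rewrite -mulnDl roundup_leq mulnDl leq_add ?roundup_ge. Qed.

Lemma roundup_fusion (m p : nat) :
  roundup (m + roundup p) = roundup m + roundup p.
Proof. by rewrite {1}/roundup addnAC divnDMl // mulnDl. Qed.

Definition roundup_endofunctor : endofunctor nat_category.
Proof.
refine (@Endofunctor nat_category roundup roundup_mono _ _);
  by move=> *; exact: nat_thin.
Defined.

Definition roundup_monad : monad nat_category.
Proof.
refine (@Monad nat_category roundup_endofunctor roundup_idem roundup_ge
  _ _ _ _ _);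
  by move=> *; exact: nat_thin.
Defined.

Lemma roundup0 : roundup 0 <= 0.
Proof. by rewrite (roundup_leq 0 0). Qed.

Definition roundup_bimonad : bimonad nat_monoidal.
Proof.
refine (@Bimonad nat_monoidal roundup_monad roundup_add roundup0
  _ _ _ _ _ _ _ _);
  by move=> *; exact: nat_thin.
Defined.

Definition roundup_hopf_monad : hopf_monad nat_monoidal.
Proof.
refine (@HopfMonad nat_monoidal roundup_bimonad _ _) => m p;
  apply: nat_is_iso => /=; first by rewrite roundup_fusion.
by rewrite [roundup m + p]addnC roundup_fusion addnC.
Defined.

Lemma roundup_hopf_image : hopf_image roundup_hopf_monad = submonoid_gen n.
Proof.
rewrite submonoid_genE; apply/seteqP; split=> [_ [m _ <-]|_ [k _ <-]].
  by exists ((m + n.-1) %/ n).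
by exists (k * n) => //; exact: roundup_muln.
Qed.

End Roundup.

Theorem theorem4p4 :
  set_bij [set: hopf_monad nat_monoidal]
    [set S : set nat | exists2 n : nat, n <> 0 & S = submonoid_gen n]
    hopf_image.
Proof.
split=> [T _ /=|S T _ _|_ [n /eqP n_neq0 ->]].
- exists ((T : nat -> nat) 1); last exact: hopf_imageE.
  by apply/eqP; rewrite -lt0n; exact: hopf_le.
- exact: hopf_image_inj.
- have n_gt0 : 0 < n by rewrite lt0n.
  by exists (roundup_hopf_monad n_gt0) => //; exact: roundup_hopf_image.
Qed.
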